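(* Let the distributions $[\delta,\pi]$ describe a continuous cloud on the reals and let $\mathcal{P}_{[\delta,\pi]}$ be the induced credal set. Then the random set defined by the Lebesgue measure on the unit interval $\alpha\in[0,1]$ and the multimapping $\alpha\longrightarrow E_\alpha$ such that $$E_\alpha=\{r\in\mathbb{R}\mid(\pi(r)\ge\alpha)\wedge(\delta(r)<\alpha)\}$$ defines a credal set $\mathcal{P}_{Bel}$ inner-approximating $\mathcal{P}_{[\delta,\pi]}$, i.e. $\mathcal{P}_{Bel}\subseteq\mathcal{P}_{[\delta,\pi]}$.
   Context: All clouds on the reals considered here are defined on a bounded interval $[\underline{r},\overline{r}]\subset\mathbb{R}$ (sets written $\{r\in\mathbb{R}\mid\ldots\}$ are understood within this domain), and $P$ ranges over $\sigma$-additive probability measures. A cloud $[\delta,\pi]$ on the reals is a pair of mappings $\delta,\pi$ with values in $[0,1]$ such that $\delta\le\pi$ pointwise, $\delta(r)=0$ for some $r$, and $\pi(r')=1$ for some $r'$. The cloud is continuous if $\delta$ and $\pi$ are continuous functions. Its credal set is $$\mathcal{P}_{[\delta,\pi]}=\{P\mid\forall\alpha\in[0,1],\ P(\{r\in\mathbb{R}\mid\delta(r)\ge\alpha\})\le1-\alpha\le P(\{r\in\mathbb{R}\mid\pi(r)>\alpha\})\}.$$ For the continuous random set given by Lebesgue measure $\lambda$ on $[0,1]$ and the multimapping $\alpha\mapsto E_\alpha$, the belief function is $Bel(A)=\lambda(\{\alpha\in[0,1]\mid E_\alpha\subseteq A\})$, and $\mathcal{P}_{Bel}=\{P\mid Bel(A)\le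 P(A)\text{ for all events }A\}$. *)

(* Defs.v *)
From mathcomp Require Import all_boot all_order all_algebra.
From mathcomp Require Import all_classical all_reals all_analysis.

Set Implicit Arguments.
Unset Strict Implicit.
Unset Printing Implicit Defensive.

Import Order.TTheory GRing.Theory Num.Theory.
Import numFieldNormedType.Exports.

Local Open Scope classical_set_scope.
Local Open Scope ring_scope.

(* The domain is the interval [a, b]. Functions on the domain are encoded as
   total functions R -> R whose values outside [a, b] are never used, and
   probability measures on the domain as Borel probability measures on R that
   give [a, b] mass 1. *)

Record cloud (R : realType) (a b : R) (delta pi : R -> R) : Prop := Cloud {
  cloud_delta01 : forall r, r \in `[a, b] -> 0 <= delta r <= 1 ;
  cloud_pi01 : forall r, r \in `[a, b] -> 0 <= pi r <= 1 ;
  cloud_le : forall r, r \in `[a, b] -> delta r <= pi r ;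
  cloud_delta0 : exists2 r, r \in `[a, b] & delta r = 0 ;
  cloud_pi1 : exists2 r, r \in `[a, b] & pi r = 1 }.

Record continuous_cloud (R : realType) (a b : R) (delta pi : R -> R) : Prop :=
  ContinuousCloud {
    continuous_cloud_cloud : cloud a b delta pi ;
    continuous_cloud_delta : {within `[a, b], continuous delta} ;
    continuous_cloud_pi : {within `[a, b], continuous pi} }.

Definition carried_by (R : realType) (a b : R)
    (P : probability (measurableTypeR R) R) : Prop :=
  P `[a, b]%classic = 1%E.

Definition cloud_credal_set (R : realType) (a b : R) (delta pi : R -> R) :
    set (probability (measurableTypeR R) R) :=
  [set P | carried_by a b P /\
    forall alpha : R, 0 <= alpha <= 1 ->
      (P [set r | r \in `[a, b] /\ (alpha <= delta r)%R] <= (1 - alpha)%:E)%E /\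
      ((1 - alpha)%:E <= P [set r | r \in `[a, b] /\ (alpha < pi r)%R])%E].

(* No measurability is required of the multimapping E here. For cloud_focal
   below the argument of lebesgue_measure is always a Borel set, whatever A is:
   its complement in [0, 1] is the union, over the points r of [a, b] outside
   A, of the intervals ]delta r, pi r], and a union of nondegenerate intervals
   is an open set plus countably many endpoints. *)
Definition belief (R : realType) (E : R -> set R) (A : set R) : \bar R :=
  lebesgue_measure [set alpha : R | 0 <= alpha <= 1 /\ E alpha `<=` A].

Definition belief_credal_set (R : realType) (a b : R) (E : R -> set R) :
    set (probability (measurableTypeR R) R) :=
  [set P | carried_by a b P /\
    forall A : set (measurableTypeR R), measurable A -> A `<=` `[a, b]%classic ->
      (belief E A <= P A)%E].

(* Focal sets may be empty (all of them are when delta = pi); an empty focal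
   set counts in the belief of every event. *)
Definition cloud_focal (R : realType) (a b : R) (delta pi : R -> R)
    (alpha : R) : set R :=
  [set r | r \in `[a, b] /\ (alpha <= pi r /\ delta r < alpha)].

(* Main.v *)
Require Import Defs.
From mathcomp Require Import all_boot all_order all_algebra.
From mathcomp Require Import all_classical all_reals all_analysis.

Set Implicit Arguments.
Unset Strict Implicit.
Unset Printing Implicit Defensive.

Import Order.TTheory GRing.Theory Num.Theory.
Import numFieldNormedType.Exports.

(** A probability dominating the belief function has to give an event A at
    least the Lebesgue measure of any interval of levels whose focal sets all
    lie in A ([le_belief_length]). The focal set of level x is
    {pi >= x} minus {delta >= x}, so
    - it lies in {pi > alpha} as soon as x > alpha, and the levels in
      ]alpha, 1] force P {pi > alpha} >= 1 - alpha;
    - it lies in {delta < alpha} as soon as x <= alpha, and the levels in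
      ]0, alpha] force P {delta < alpha} >= alpha, which is
      P {delta >= alpha} <= 1 - alpha because P is carried by [a, b].
    Continuity of delta and pi serves to make {pi > alpha} and
    {delta < alpha} Borel sets, that is, events on which P dominates the
    belief function. *)

Local Open Scope classical_set_scope.
Local Open Scope ring_scope.

(** Replaces the exact set of levels that counts in the belief of A by an
    interval inside it; the open end at c is what a strict superlevel set
    requires. *)
Lemma le_belief_length (R : realType) (E : R -> set R) (A : set R) (c d : R) :
  0 <= c -> c <= d -> d <= 1 ->
  (forall x, c < x -> x <= d -> E x `<=` A) -> ((d - c)%:E <= belief E A)%E.
Proof.
move=> c0 cd d1 EA.
have -> : (d - c)%:E = lebesgue_measure `]c, d]%classic.
  rewrite lebesgue_measure_itv/= lte_fin -EFinB.
  by case: ltgtP cd => // -> _; rewrite subrr.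
(* The Lebesgue measure is an outer measure on all subsets of R, hence monotone
   without any measurability of the set of levels that defines the belief. *)
apply: le_outer_measure => x /=; rewrite in_itv/= => /andP[cx xd].
split; last exact: EA.
by rewrite (le_trans c0 (ltW cx)) (le_trans xd).
Qed.

Lemma measurable_superlevel (R : realType) (a b : R) (f : R -> R) (x : R) :
  {within `[a, b], continuous f} ->
  measurable ([set r | r \in `[a, b] /\ x < f r] : set (measurableTypeR R)).
Proof.
move=> cf; have mf := measurable_realfun.subspace_continuous_measurable_fun
  (measurable_itv _) cf.
have := mf (measurable_itv _) `]x, +oo[%classic (measurable_itv _).
by congr measurable; apply/seteqP; split=> r /=; rewrite !in_itv/= andbT.
Qed.

Lemma measurable_sublevel (R : realType) (a b : R) (f : R -> R) (x : R) :
  {within `[a, b], continuous f} ->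
  measurable ([set r | r \in `[a, b] /\ f r < x] : set (measurableTypeR R)).
Proof.
move=> cf; have mf := measurable_realfun.subspace_continuous_measurable_fun
  (measurable_itv _) cf.
have := mf (measurable_itv _) `]-oo, x[%classic (measurable_itv _).
by congr measurable; apply/seteqP; split=> r /=; rewrite !in_itv/=.
Qed.

Theorem proposition7 (R : realType) (a b : R) (delta pi : R -> R)
    (Hcloud : continuous_cloud a b delta pi) :
  belief_credal_set a b (cloud_focal a b delta pi)
    `<=` cloud_credal_set a b delta pi.
Proof.
case: Hcloud => _ cdelta cpi P [Pab belP]; split=> // alpha /andP[alpha0 alpha1].
split.
- set A : set (measurableTypeR R) := [set r | r \in `[a, b] /\ delta r < alpha].
  have mA : measurable A by exact: measurable_sublevel.
  have Aab : A `<=` `[a, b]%classic by move=> r [].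
  have alphaA : (alpha%:E <= P A)%E.
    (* alpha is the length of the interval of levels ]0, alpha] *)
    apply: le_trans (belP _ mA Aab); rewrite -[X in X%:E]subr0.
    apply: le_belief_length => // x _ xalpha r [rab [_ dx]].
    by split=> //; exact: lt_le_trans xalpha.
  have -> : [set r | r \in `[a, b] /\ alpha <= delta r] = `[a, b]%classic `\` A.
    apply/seteqP; split=> r /= [rab].
      by move=> adr; split=> // -[_]; rewrite ltNge adr.
    by move=> nA; split=> //; rewrite leNgt; apply/negP => dr; apply: nA.
  have mab : measurable (`[a, b]%classic : set (measurableTypeR R)).
    exact: measurable_itv.
  have -> : P (`[a, b]%classic `\` A) = (P `[a, b]%classic - P A)%E.
    rewrite measureD// ?setIidr//.
    by rewrite [X in (X < _)%E]Pab ltry.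
  by rewrite Pab EFinB leeB.
- set A : set (measurableTypeR R) := [set r | r \in `[a, b] /\ alpha < pi r].
  have mA : measurable A by exact: measurable_superlevel.
  have Aab : A `<=` `[a, b]%classic by move=> r [].
  apply: le_trans (belP _ mA Aab).
  apply: le_belief_length => // x alphax _ r [rab [xpi _]].
  by split=> //; exact: lt_le_trans xpi.
Qed.
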